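(* Let $d\geq 1$ and $k\geq 1$ be integers, and let $G$ be a connected $(k,k-d)$-regular graph. If $k\geq d^2-d+1$, then $d$ divides $k$, and $G$ is isomorphic to the complete multipartite graph $K_{\frac{k+d}{d}}[\overline{K_{d}}]$ (the lexicographic product of the complete graph on $\frac{k+d}{d}$ vertices with the edgeless graph on $d$ vertices).
   Context: All graphs are simple, possibly infinite, but with finite valency. For a vertex $v$ of a graph $G$, the local graph $G_v$ is the subgraph of $G$ induced on the neighbourhood $N(v)$. A graph $G$ is $(k,t)$-regular if it is $k$-regular and every local graph $G_v$ is $t$-regular (equivalently, every vertex lies in $k$ edges and every edge lies in exactly $t$ triangles). *)

(* Defs.v *)
From mathcomp Require Import all_boot.
From mathcomp Require Import classical_sets cardinality.
From Stdlib Require Import Relation_Operators.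

Set Implicit Arguments.
Unset Strict Implicit.
Unset Printing Implicit Defensive.

Local Open Scope classical_set_scope.
Local Open Scope card_scope.

Record sgraph := SGraph {
  vertex :> Type;
  adj : vertex -> vertex -> Prop;
  adj_sym : forall x y, adj x y -> adj y x;
  adj_irrefl : forall x, ~ adj x x }.

Definition nbhd (G : sgraph) (v : G) : set G := [set w | adj v w].

Lemma induced_sym (G : sgraph) (A : set G) (x y : {x | A x}) :
  adj (sval x) (sval y) -> adj (sval y) (sval x).
Proof. exact: adj_sym. Qed.

Lemma induced_irrefl (G : sgraph) (A : set G) (x : {x | A x}) :
  ~ adj (sval x) (sval x).
Proof. exact: adj_irrefl. Qed.

Definition induced (G : sgraph) (A : set G) : sgraph :=
  SGraph (@induced_sym G A) (@induced_irrefl G A).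

Definition local_graph (G : sgraph) (v : G) : sgraph := induced (nbhd v).

Definition regular (G : sgraph) (k : nat) : Prop :=
  forall v : G, nbhd v #= `I_k.

Definition kt_regular (G : sgraph) (k t : nat) : Prop :=
  regular G k /\ forall v : G, regular (local_graph v) t.

(* The null graph does not count as connected. *)
Definition connected (G : sgraph) : Prop :=
  inhabited G /\ forall x y : G, clos_refl_trans G (@adj G) x y.

Definition isomorphic (G H : sgraph) : Prop :=
  exists f : G -> H,
    bijective f /\ forall x y : G, adj x y <-> adj (f x) (f y).

Lemma complete_sym n (x y : 'I_n) : x <> y -> y <> x.
Proof. by move=> xy yx; apply: xy. Qed.

Lemma complete_irrefl n (x : 'I_n) : ~ x <> x.
Proof. by apply. Qed.

Definition complete (n : nat) : sgraph :=
  SGraph (@complete_sym n) (@complete_irrefl n).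

Section Complement.
Variable G : sgraph.

Definition compl_adj (x y : G) : Prop := x <> y /\ ~ adj x y.

Lemma compl_sym x y : compl_adj x y -> compl_adj y x.
Proof. by move=> [xy nxy]; split=> [/esym//|/adj_sym]. Qed.

Lemma compl_irrefl x : ~ compl_adj x x.
Proof. by case. Qed.

Definition complement : sgraph := SGraph compl_sym compl_irrefl.
End Complement.

Section Lexicographic.
Variables G H : sgraph.

Definition lex_adj (p q : G * H) : Prop :=
  adj p.1 q.1 \/ (p.1 = q.1 /\ adj p.2 q.2).

Lemma lex_sym p q : lex_adj p q -> lex_adj q p.
Proof. by case=> [/adj_sym|[pq /adj_sym]]; [left|right]. Qed.

Lemma lex_irrefl p : ~ lex_adj p p.
Proof. by case=> [/adj_irrefl|[_ /adj_irrefl]]. Qed.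

(* G[H]: each vertex of G is replaced by a copy of H. *)
Definition lexprod : sgraph := SGraph lex_sym lex_irrefl.
End Lexicographic.

(* Main.v *)
(** Let [u], [w] be at distance 2, with [c] common neighbours.  Inside the
    neighbourhood of any of these, [u] and [w] are each non-adjacent to exactly [d]
    vertices, among them both [u] and [w], so [c >= k - 2d + 3].  Counting the edges between
    [N(u) \ N(w)] and [N(u) :&: N(w)] gives [(k - c)(c - d + 1) <= c (d - 2)], and
    with [k >= d^2 - d + 1] this forces [c >= k - d + 2].  Since exactly [k (d - 1)]
    edges join [N(u)] to the second neighbourhood of [u], the latter has only
    [d - 1] vertices and [N(u) = N(w)].  By connectedness, non-adjacency is then
    an equivalence relation whose classes have [d] elements. *)

From Stdlib Require Import Relation_Operators Operators_Properties.
Require Import Defs.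
From mathcomp Require Import all_boot.
From mathcomp Require Import boolp classical_sets functions cardinality zify.

Set Implicit Arguments.
Unset Strict Implicit.
Unset Printing Implicit Defensive.

Local Open Scope nat_scope.

(** * Counting along sequences *)

Lemma uniq_leq_count (T : eqType) (P : pred T) (s r : seq T) :
  uniq r -> {subset r <= s} -> all P r -> size r <= count P s.
Proof.
move=> ur rs /allP Pr; rewrite -size_filter; apply: uniq_leq_size => // x xr.
by rewrite mem_filter Pr ?rs.
Qed.

Lemma double_count (S T : Type) (r : S -> T -> bool) (s : seq S) (t : seq T) :
  \sum_(x <- s) count (r x) t = \sum_(y <- t) count (r ^~ y) s.
Proof.
under eq_bigr do rewrite -sum1_count big_mkcond /=.
rewrite exchange_big /=; apply: eq_bigr => y _.
by rewrite -sum1_count [RHS]big_mkcond.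
Qed.

Lemma leq_sum_seq_const (T : eqType) (s : seq T) (F : T -> nat) (m : nat) :
  {in s, forall x, F x <= m} -> \sum_(x <- s) F x <= size s * m.
Proof.
move=> Fm; rewrite big_seq (@leq_trans (\sum_(x <- s | x \in s) m)) ?leq_sum//.
by rewrite -big_seq big_const_seq count_predT iter_addn_0 mulnC.
Qed.

Lemma geq_sum_seq_const (T : eqType) (s : seq T) (F : T -> nat) (m : nat) :
  {in s, forall x, m <= F x} -> size s * m <= \sum_(x <- s) F x.
Proof.
move=> Fm; rewrite big_seq (@leq_trans (\sum_(x <- s | x \in s) m)) ?leq_sum//.
by rewrite -big_seq big_const_seq count_predT iter_addn_0 mulnC.
Qed.

(* With [j := k - c], the fourth hypothesis says that a quadratic in [j], concave
   and positive at both ends of the range [d - 1 <= j <= 2 * d - 3], is at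
   most [0]; the fifth one gives [j <= 2 * d - 3], so that [j <= d - 2]. *)
Lemma common_gap (c d k : nat) : 2 <= d -> d ^ 2 - d + 1 <= k -> c <= k ->
  (k - c) * (c + 1 - d) <= c * (d - 2) -> k + 3 <= c + 2 * d -> k + 2 <= c + d.
Proof.
move=> d2 kd ck Hf Hw; rewrite leqNgt; apply/negP => Hc.
(* [i] and [l] are the distances of [k - c] from the two ends of its range; [p] is [d - 2]. *)
have [i ki] : exists i, k = c + d.-1 + i by exists (k - c - d.-1); lia.
have [l dl] : exists l, d = i + l + 2 by exists (d - i - 2); lia.
have [p pE] : exists p, p = i + l by eexists.
have dp : d = p.+2 by lia.
have {ki}kp : k = c + p.+1 + i by lia.
clear dl; subst d k; move: kd; rewrite expnS expn1 [X in X - _]mulnS addKn => kd.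
have lb : p.+1 * p.+1 + 1 <= c + i by clear -kd; lia.
have [b cb] : exists b, c = b + p.+1 by exists (c - p.+1); clear -pE lb; nia.
clear kd Hw Hc d2 ck.
have Hb : b * (i + 1) <= p.+1 * p.
  move: Hf; have -> : c + p.+1 + i - c = p.+1 + i by lia.
  have -> : c + 1 - p.+2 = b by lia.
  by rewrite cb -addn2 addnK; clear; lia.
clear Hf; subst c.
(* With [Hb], this leaves [i * p * p + i * p + 1 <= i * i], against [i <= p]. *)
have H := leq_mul lb (leqnn (i + 1)).
have H1 : i * i <= i * p by rewrite pE leq_mul2l leq_addr orbT.
have H2 : i * p <= i * p * p by case: (p) => [|q]; rewrite ?muln0 ?leq_pmulr.
clear lb pE; lia.
Qed.

(** * Vertices at distance 2 are twins *)

Section LocallyRegular.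
Variables (T : eqType) (e : rel T) (nb : T -> seq T) (d k : nat).
Hypotheses (e_sym : symmetric e) (e_irr : irreflexive e).
Hypotheses (nb_uniq : forall v, uniq (nb v)) (mem_nb : forall v x, (x \in nb v) = e v x).
Hypotheses (size_nb : forall v, size (nb v) = k).
Hypothesis count_edge : forall u v, e u v -> count (e v) (nb u) = k - d.
Hypothesis k_lb : d ^ 2 - d + 1 <= k.

Let dk : d <= k. Proof. move: k_lb; rewrite expnS expn1; nia. Qed.

(** The [d] vertices include [v], which is not adjacent to itself. *)
Lemma count_non_edge u v : e u v -> count (predC (e v)) (nb u) = d.
Proof.
by move=> uv; have := count_predC (e v) (nb u); rewrite count_edge// size_nb; lia.
Qed.

Definition dist2 u w := [/\ u != w, ~~ e u w & exists2 v, e u v & e v w].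

Lemma dist2_sym u w : dist2 u w -> dist2 w u.
Proof.
case=> uw nuw [v uv vw]; split; [by rewrite eq_sym|by rewrite e_sym|].
by exists v; rewrite e_sym.
Qed.

(** In [N(v)], for a common neighbour [v], the non-neighbours of [u] and those of [w] share [u] and
    [w], so at least [k - 2d + 2] vertices are adjacent to both; [v] itself is one more. *)
Lemma dist2_common_weak u w : dist2 u w -> k + 3 <= count (e w) (nb u) + 2 * d.
Proof.
case=> uw nuw [v uv vw]; have vu : e v u by rewrite e_sym.
have Hc : (count (predI (e u) (e w)) (nb v)).+1 <= count (e w) (nb u).
  rewrite -size_filter -[X in X <= _]/(size (v :: _)).
  apply: uniq_leq_count.
  - by rewrite /= mem_filter mem_nb e_irr andbF filter_uniq.
  - move=> x; rewrite in_cons mem_filter !mem_nb.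
    by case/orP => [/eqP->|/andP[/andP[]]].
  - by rewrite /= e_sym vw; apply/allP => x; rewrite mem_filter => /andP[/andP[]].
have Hi : 2 <= count (predI (predC (e u)) (predC (e w))) (nb v).
  apply: (@uniq_leq_count _ _ _ [:: u; w]).
  - by rewrite /= inE uw.
  - by move=> x; rewrite !in_cons in_nil orbF mem_nb => /orP[] /eqP->.
  - by rewrite /= !e_irr nuw e_sym nuw.
have := count_predUI (predC (e u)) (predC (e w)) (nb v).
rewrite !count_non_edge// => HU.
have := count_predC (predI (e u) (e w)) (nb v).
have /eq_count-> : predC (predI (e u) (e w)) =1 predU (predC (e u)) (predC (e w)).
  by move=> x /=; rewrite negb_and.
by rewrite size_nb; lia.
Qed.

(* Counts the edges between [N(u) \ N(w)] and [N(u) :&: N(w)]. *)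
Lemma dist2_edge_count u w : let c := count (e w) (nb u) in
  dist2 u w -> (k - c) * (c + 1 - d) <= c * (d - 2).
Proof.
move=> c uw2; have [uw nuw _] := uw2.
set A := filter (predC (e w)) (nb u); set C := filter (e w) (nb u).
have sA : size A = k - c.
  by rewrite size_filter; have := count_predC (e w) (nb u); rewrite size_nb -/c; lia.
have sC : size C = c by rewrite size_filter.
rewrite -sA -sC.
apply: (@leq_trans (\sum_(a <- A) count (e a) C)).
  apply: geq_sum_seq_const => a; rewrite mem_filter mem_nb => /andP[nwa ua].
  (* [a] is one of its own [d] non-neighbours in [N(u)] and lies outside [C]. *)
  have : (count (predC (e a)) C).+1 <= count (predC (e a)) (nb u).
    rewrite -size_filter -[X in X <= _]/(size (a :: _)).
    apply: uniq_leq_count.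
    - by rewrite /= !mem_filter (negbTE nwa) !andbF !filter_uniq.
    - move=> x; rewrite inE !mem_filter => /orP[/eqP->|/and3P[]//].
      by rewrite mem_nb.
    - by rewrite /= e_irr; apply/allP => x; rewrite mem_filter => /andP[].
  by rewrite count_non_edge//; have := count_predC (e a) C; rewrite sC; lia.
rewrite double_count; apply: leq_sum_seq_const => v; rewrite mem_filter mem_nb.
move=> /andP[wv uv].
(* Among the [d] non-neighbours of [w] in [N(v)], both [u] and [w] lie outside [A]. *)
have : (count (e ^~ v) A).+2 <= count (predC (e w)) (nb v).
  rewrite -size_filter -[X in X <= _]/(size (w :: u :: _)).
  apply: uniq_leq_count.
  - rewrite /= inE eq_sym (negbTE uw) !mem_filter !mem_nb e_irr.
    by rewrite (negbTE nuw) !andbF !filter_uniq.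
  - move=> x; rewrite !in_cons !mem_filter !mem_nb.
    by case/or3P=> [/eqP->|/eqP->|/andP[]]; rewrite e_sym.
  - rewrite /= e_irr e_sym nuw; apply/allP => x.
    by rewrite !mem_filter => /and3P[].
by rewrite count_non_edge 1?e_sym//; lia.
Qed.

Lemma dist2_common u w : dist2 u w -> k + 2 <= count (e w) (nb u) + d.
Proof.
move=> uw2; have := dist2_common_weak uw2; have := dist2_edge_count uw2 => /=.
have [uw nuw [v uv vw]] := uw2.
have d2 : 2 <= d.
  rewrite -(@count_non_edge v w)//; apply: (@uniq_leq_count _ _ _ [:: u; w]).
  - by rewrite /= inE uw.
  - by move=> x; rewrite !in_cons in_nil orbF mem_nb => /orP[] /eqP->//; rewrite e_sym.
  - by rewrite /= e_irr e_sym nuw.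
move=> Hf Hw; apply: common_gap => //.
by rewrite -(size_nb u) count_size.
Qed.

(* If [v] were not adjacent to [w], then [w] and the [d - 1] vertices of
   [N(v) \ N[u]] would be [d] vertices at distance 2 from [u], sending at least
   [d (k + 2 - d)] edges to [N(u)]; only [k (d - 1)] edges leave [N(u)] that way. *)
Lemma dist2_adj u w v : dist2 u w -> e u v -> e v w.
Proof.
move=> uw2 uv; have [uw nuw _] := uw2; apply: contraT => nvw.
have vu : e v u by rewrite e_sym.
set W := filter (fun x => (x != u) && ~~ e u x) (nb v).
have sW : (size W).+1 = d.
  rewrite -(count_non_edge vu) size_filter -[X in X.+1]add0n -addSn.
  have -> : 1 = count (pred1 u) (nb v) by rewrite count_uniq_mem// mem_nb vu.
  have := count_predUI (pred1 u) (fun x => (x != u) && ~~ e u x) (nb v).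
  rewrite (@eq_count _ (predI _ _) pred0) ?count_pred0 ?addn0; last first.
    by move=> x /=; case: eqP.
  move=> <-; apply: eq_count => x /=.
  by case: eqP => // ->; rewrite e_irr.
have lb : size (w :: W) * (k + 2 - d) <= \sum_(x <- w :: W) count (e x) (nb u).
  apply: geq_sum_seq_const => x; rewrite inE mem_filter mem_nb => xW.
  suff /dist2_common : dist2 u x by lia.
  case/orP: xW => [/eqP->//|/andP[/andP[xu nux] vx]].
  by split; [rewrite eq_sym| |exists v].
have ub : \sum_(x <- w :: W) count (e x) (nb u) <= size (nb u) * (d - 1).
  rewrite double_count; apply: leq_sum_seq_const => y; rewrite mem_nb => uy.
  have yu : e y u by rewrite e_sym.
  (* [u] is one of its own [d] non-neighbours in [N(y)], which leaves at most [d - 1] for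
     [w :: W]. *)
  have : (count (e ^~ y) (w :: W)).+1 <= count (predC (e u)) (nb y).
    rewrite -size_filter -[X in X <= _]/(size (u :: filter (e ^~ y) (w :: W))).
    have nW x : x \in w :: W -> (x != u) && ~~ e u x.
      by rewrite inE mem_filter => /orP[/eqP->|/andP[]//]; rewrite eq_sym uw.
    apply: uniq_leq_count.
    - rewrite cons_uniq; apply/andP; split.
        by rewrite mem_filter; apply/negP => /andP[_ /nW]; rewrite eqxx.
      by rewrite filter_uniq//= filter_uniq// andbT mem_filter mem_nb (negbTE nvw) andbF.
    - move=> x; rewrite in_cons mem_filter !mem_nb.
      by case/orP => [/eqP->//|/andP[]]; rewrite e_sym.
    - apply/allP => x; rewrite in_cons mem_filter.
      by case/orP => [/eqP->|/andP[_ /nW/andP[]]//]; rewrite /= e_irr.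
  by rewrite count_non_edge//; lia.
move: (leq_trans lb ub); rewrite /= sW size_nb.
move: k_lb dk; case: (d) sW => // q _; rewrite expnS expn1 mulnS addKn => kq qk.
(* Here [d = q + 1]: the two bounds give [q + j + 2 <= q ^ 2], while [kq] gives [q ^ 2 <= j]. *)
have [j kj] : exists j, k = q.+1 + j by exists (k - q.+1); lia.
by rewrite kj subSS subn0 (_ : q.+1 + j + 2 - q.+1 = j + 2); lia.
Qed.

Lemma dist2_twin u w : dist2 u w -> e u =1 e w.
Proof.
move=> uw x; apply/idP/idP => h; first by rewrite e_sym (dist2_adj uw).
by rewrite e_sym (dist2_adj (dist2_sym uw)).
Qed.

Hypothesis e_conn : forall u x, clos_refl_trans T e u x.

(** Induction along a walk from [u]: after a neighbour [y] of [u], the next vertex is [u], adjacent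
    to [u] or at distance 2; after a twin of [u], it is adjacent to [u]. *)
Lemma adj_or_twin u x : e u x \/ e u =1 e x.
Proof.
elim: (clos_rt_rtn1 _ _ _ _ (e_conn u x)) => [|y z yz _ [uy|uy]]; first by right.
  have [|nuz] := boolP (e u z); [by left|right].
  have [->//|uz] := eqVneq u z.
  by apply: dist2_twin; split => //; exists y.
by left; rewrite uy.
Qed.

Lemma non_adj_twin u x : ~~ e u x -> e u =1 e x.
Proof. by move=> /negP nux; case: (adj_or_twin u x). Qed.

(** A non-neighbour of [u] is a twin of [u], hence adjacent to [v]: the vertices are [N(u)] and the
    [d] vertices of [N(v) \ N(u)]. *)
Lemma vertex_seq (u v : T) : e u v ->
  exists s : seq T, [/\ uniq s, size s = k + d & forall x, x \in s].
Proof.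
move=> uv; exists (nb u ++ filter (predC (e u)) (nb v)); split.
- rewrite cat_uniq nb_uniq filter_uniq// andbT; apply/hasPn => x.
  by rewrite mem_filter => /andP[nux _] /=; rewrite mem_nb.
- by rewrite size_cat size_nb size_filter count_non_edge// e_sym.
- move=> x; rewrite mem_cat mem_filter !mem_nb /=; have [//|nux] := boolP (e u x).
  by rewrite /= e_sym -(non_adj_twin nux).
Qed.

Lemma count_non_adj (s : seq T) x : uniq s -> (forall y, y \in s) -> size s = k + d ->
  count (predC (e x)) s = d.
Proof.
move=> us ms ss; have := count_predC (e x) s.
have -> : count (e x) s = k; last by rewrite ss => /addnI.
rewrite -(size_nb x) -size_filter; apply/perm_size/uniq_perm => //.
  exact: filter_uniq.
by move=> y; rewrite mem_filter ms andbT mem_nb.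
Qed.

End LocallyRegular.

(** * Twin classes of equal size form a complete multipartite graph *)

Section Multipartite.
Variables (T : eqType) (e : rel T) (s : seq T) (d : nat) (x0 : T).
Hypotheses (e_irr : irreflexive e) (s_uniq : uniq s) (mem_s : forall x, x \in s).
Hypothesis twins : forall x y, ~~ e x y -> e x =1 e y.
Hypothesis count_part : forall x, count (predC (e x)) s = d.

Let part x := filter (predC (e x)) s.
(** Canonical, since twins filter the same sequence out of [s]; the default is never reached, as [x]
    lies in [part x]. *)
Let rep x := head x (part x).
Let reps := undup (map rep s).

Let mem_part x y : (y \in part x) = ~~ e x y.
Proof. by rewrite mem_filter mem_s andbT. Qed.

Let part_eq x y : ~~ e x y -> part x = part y.
Proof. by move=> /twins xy; apply: eq_filter => z; rewrite /= xy. Qed.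

Let rep_part x : ~~ e x (rep x).
Proof.
rewrite -mem_part /rep; have : x \in part x by rewrite mem_part e_irr.
by case: (part x) => //= y r _; rewrite mem_head.
Qed.

Let rep_eqP x y : (rep x == rep y) = ~~ e x y.
Proof.
apply/eqP/idP => [xy|nxy].
  by rewrite (twins (rep_part x)) xy -(twins (rep_part y)) e_irr.
rewrite /rep (part_eq nxy); have : y \in part y by rewrite mem_part e_irr.
by case: (part y).
Qed.

Let rep_reps x : rep x \in reps.
Proof. by rewrite mem_undup map_f. Qed.

Let rep_id r : r \in reps -> rep r = r.
Proof.
rewrite mem_undup => /mapP[x _ ->]; apply/eqP.
by rewrite rep_eqP -(twins (rep_part x)) e_irr.
Qed.

Let size_part x : size (part x) = d.
Proof. by rewrite size_filter. Qed.

(** Each vertex has one representative, and each representative stands for [d] vertices. *)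
Let size_reps : size s = size reps * d.
Proof.
have -> : size s = \sum_(x <- s) count_mem (rep x) reps.
  rewrite -[LHS]sum1_size; apply: eq_bigr => x _.
  by rewrite count_uniq_mem ?undup_uniq// rep_reps.
under eq_bigr do rewrite -sum1_count big_mkcond /=.
rewrite exchange_big /= big_seq.
rewrite (eq_bigr (fun=> d)); last first.
  move=> r /rep_id rr; rewrite -big_mkcond sum1_count -(count_part r).
  by apply: eq_count => x /=; rewrite -[X in X == _]rr rep_eqP.
by rewrite -big_seq big_const_seq count_predT iter_addn_0 mulnC.
Qed.

(** The coordinates of a vertex are the index of its class and its index within the class. *)
Lemma twins_multipartite : exists2 m, size s = m * d &
  exists2 f : T -> 'I_m * 'I_d, bijective f &
    forall x y, e x y = ((f x).1 != (f y).1).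
Proof.
exists (size reps); first exact: size_reps.
have b1 x : index (rep x) reps < size reps by rewrite index_mem.
have b2 x : index x (part x) < d by rewrite -(size_part x) index_mem mem_part e_irr.
exists (fun x => (Ordinal (b1 x), Ordinal (b2 x))); last first.
  move=> x y; apply/idP/idP => [exy|].
    apply/eqP => /= -[] /index_inj xy.
    by have := rep_eqP x y; rewrite xy// eqxx exy.
  by apply: contraNT; rewrite -rep_eqP => /eqP xy; apply/eqP/val_inj; rewrite /= xy.
exists (fun ij : 'I_(size reps) * 'I_d => nth x0 (part (nth x0 reps ij.1)) ij.2).
  move=> x /=; rewrite nth_index// -(part_eq (rep_part x)) nth_index//.
  by rewrite mem_part e_irr.
move=> [i j] /=; set r := nth x0 reps i; set y := nth _ _ _.
have rr : r \in reps by rewrite mem_nth.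
have ry : ~~ e r y by rewrite -mem_part mem_nth// size_part.
congr pair; apply: val_inj => /=.
  have /eqP <- : rep r == rep y by rewrite rep_eqP.
  by rewrite rep_id// index_uniq// undup_uniq.
by rewrite -(part_eq ry) index_uniq ?size_part// filter_uniq.
Qed.
End Multipartite.

(** * From cardinalities of sets to enumerations *)

Lemma card_eq_seq (T : eqType) (A : set T) (n : nat) : (A #= `I_n)%card ->
  exists s : seq T, [/\ uniq s, size s = n & forall x, x \in s <-> A x].
Proof.
move=> An; have /finite_seqP[s As] : finite_set A by exists n.
exists (undup s).
have sA x : x \in undup s <-> A x by rewrite mem_undup As.
split=> //; first exact: undup_uniq.
have [f [fA f_inj f_surj]] := card_set_bijP An.
rewrite -(size_iota 0 n) -(size_map f); apply: perm_size; apply: uniq_perm.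
- rewrite map_inj_in_uniq ?undup_uniq// => x y /sA Ax /sA Ay.
  by apply: f_inj; rewrite inE.
- exact: iota_uniq.
- move=> i; rewrite mem_iota add0n /=.
  apply/mapP/idP => [[x /sA Ax ->]|/f_surj[x /sA Ax <-]].
    exact: fA.
  by exists x.
Qed.

Lemma kt_regular_seq (G : sgraph) (k t : nat) : kt_regular G k t ->
  exists nb : {classic G} -> seq {classic G},
    [/\ forall v, uniq (nb v), forall v, size (nb v) = k,
        forall v x, (x \in nb v) = `[< adj v x >] &
        forall u v, adj u v -> count (fun x => `[< adj v x >]) (nb u) = t].
Proof.
move=> [Gk Gt].
have /choice[nb nbP] (v : {classic G}) := @card_eq_seq {classic G} _ _ (Gk v).
have mem_nb v x : (x \in nb v) = `[< adj v x >].
  by have [_ _ nbv] := nbP v; apply/idP/asboolP => /nbv.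
exists nb; split=> // [v|v|u v uv]; [by case: (nbP v)|by case: (nbP v)|].
have [s [us <- ms]] := @card_eq_seq {classic (local_graph u)} _ _ (Gt u (exist _ v uv)).
(* [emb] carries the neighbourhood of [v] in the local graph at [u] onto the common neighbours of
   [u] and [v]. *)
pose emb : {classic (local_graph u)} -> {classic G} := sval.
have emb_inj : injective emb.
  by move=> [x xP] [y yP] /= xy; apply: eq_exist.
rewrite -(size_map emb) -size_filter.
apply: (@perm_size {classic G}); apply: uniq_perm.
- by apply: filter_uniq; case: (nbP u).
- by rewrite map_inj_uniq.
- move=> x; rewrite mem_filter mem_nb; apply/andP/mapP => [[/asboolP vx /asboolP ux]|].
    by exists (exist _ x ux) => //; apply/ms.
  by move=> [[y uy] /ms vy ->]; split; apply/asboolP.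
Qed.

(** * The isomorphism *)

Theorem theorem1p2 (d k : nat) (G : sgraph) :
  1 <= d -> 1 <= k ->
  connected G -> kt_regular G k (k - d) ->
  d ^ 2 - d + 1 <= k ->
  d %| k /\
  isomorphic G (lexprod (complete ((k + d) %/ d)) (complement (complete d))).
Proof.
move=> d_gt0 k_gt0 [[x0] Gconn] /kt_regular_seq[nb [nb_uniq size_nb mem_nb nbE]] kd.
pose e : rel {classic G} := fun x y => `[< adj x y >].
have e_sym : symmetric e by move=> x y; apply/asboolP/asboolP => /adj_sym.
have e_irr : irreflexive e by move=> x; apply/asboolP/adj_irrefl.
have count_edge u v : e u v -> count (e v) (nb u) = k - d by move/asboolP/nbE.
have e_conn u x : clos_refl_trans {classic G} e u x.
  elim: (Gconn u x) => [y z yz|y|y z t _ yz _ zt].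
  - by apply: rt_step; apply/asboolP.
  - exact: rt_refl.
  - exact: rt_trans yz zt.
have [v x0v] : exists v, e x0 v.
  have := size_nb x0; case E: (nb x0) => [|v r] /= kE; first by rewrite -kE in k_gt0.
  by exists v; rewrite /e -mem_nb E mem_head.
have [s [us ss ms]] :=
  vertex_seq e_sym e_irr nb_uniq mem_nb size_nb count_edge kd e_conn x0v.
have twin := non_adj_twin e_sym e_irr nb_uniq mem_nb size_nb count_edge kd e_conn.
have parts x : count (predC (e x)) s = d.
  exact: (count_non_adj nb_uniq mem_nb size_nb x us ms ss).
have [m] := twins_multipartite (x0 : {classic G}) e_irr us ms twin parts.
rewrite ss => mE [f f_bij fE].
have -> : (k + d) %/ d = m by rewrite mE mulnK.
split; first by rewrite -(dvdn_addl _ (dvdnn d)) mE dvdn_mull.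
exists f; split=> // x y; split.
  by move=> /asboolP; rewrite -/(e x y) fE => /eqP; left.
(* The second factor is edgeless: an edge would join vertices both distinct and not distinct. *)
by case=> [/eqP|[_ [ne []]]//]; rewrite -fE => /asboolP.
Qed.
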